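(* Let $x,y$ be integers and let $z_0,z_1$ be integers held by $S_0$ and $S_1$ respectively with $z_1-z_0\equiv 2\alpha\cdot x\cdot y\pmod N$ (as output by $\mathtt{SMUL}_{\mathrm{HSS}}$). Let $c^*=\llbracket(2\alpha)^{-1}\bmod N\rrbracket$ be a FastPai encryption of $(2\alpha)^{-1}\bmod N$ known to both servers. Run protocol $\mathtt{S2C}$: for $i\in\{0,1\}$, $S_i$ computes $w_i=\mathrm{DDLog}_N((c^* )^{z_i}\bmod N^2)$ and a FastPai encryption $\llbracket w_i\rrbracket$, and sends it to the other server; both then compute $C=\llbracket w_1\rrbracket\cdot\llbracket w_0\rrbracket^{-1}\bmod N^2$. Then $C$ is an encryption of $x\cdot y\bmod N$, i.e. $\mathrm{Dec}(C)\equiv x y\pmod N$.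
   Context: FastPai: for a security parameter $\kappa$, $l(\kappa)=4\kappa$. $N=PQ$ with $P,Q$ primes of $n(\kappa)/2$ bits, $p,q$ odd primes of $l(\kappa)/2$ bits, $p\mid P-1$, $q\mid Q-1$, $P\equiv Q\equiv3\pmod4$, $\gcd(P-1,Q-1)=2$, $\gcd(pq,(P-1)(Q-1)/(4pq))=1$. Private key $\alpha=pq$; $\beta=(P-1)(Q-1)/(4pq)$; $h=-y_0^{2\beta}\bmod N$ for random $y_0\in\mathbb{Z}_N^*$; public key $(N,h)$. $\mathrm{Enc}(m)=(1+N)^m(h^r\bmod N)^N\bmod N^2$, $r$ uniform in $\{0,1\}^{l(\kappa)}$, written $\llbracket m\rrbracket$; $\mathrm{Dec}(c)=L(c^{2\alpha}\bmod N^2)(2\alpha)^{-1}\bmod N$, $L(u)=(u-1)/N$. Negative integers $m$ are encoded as $N-|m|$. Ciphertext inverses and exponentiations (possibly by negative integers) are in $\mathbb{Z}_{N^2}^*$. $\mathrm{DDLog}_N(g)=\lfloor g/N\rfloor\cdot(g\bmod N)^{-1}\bmod N$ for $g\in[0,N^2)$ with $g\bmod N$ invertible mod $N$.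
   Formalization: The shares satisfy the exact integer equality z₁ − z₀ = 2α·x·y in place of the congruence modulo N, and the bit length n(κ) is taken greater than l(κ) = 4κ. Apart from conventions, each condition added here is assumed in the paper as well or is needed for the statement above to hold. *)

(* Defs.v *)
From mathcomp Require Import all_boot all_order all_algebra.
Set Implicit Arguments. Unset Strict Implicit. Unset Printing Implicit Defensive.
Import Order.TTheory GRing.Theory Num.Theory.
Local Open Scope ring_scope.

(* Modular inverse of a modulo n via Bezout coefficients: u*a + v*n = gcd a n,
   so when gcd a n = 1, (u mod n) is the inverse of a in Z_n^*. *)
Definition invmod (a n : int) : int := ((egcdz a n).1 %% n)%Z.

Definition powmod (g e n : int) : int :=
  if 0 <= e then ((g ^+ `|e|%N) %% n)%Z else ((invmod g n ^+ `|e|%N) %% n)%Z.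

Definition has_bits (b x : nat) : Prop := (2 ^ b.-1 <= x < 2 ^ b)%N.

Definition fp_beta (P Q p q : nat) : nat := ((P.-1 * Q.-1) %/ (4 * (p * q)))%N.

Definition fp_h (N y0 beta : nat) : int := ((- (y0%:Z ^+ (2 * beta)%N)) %% N%:Z)%Z.

Definition fp_Enc (N : nat) (h : int) (m : int) (r : nat) : int :=
  ((powmod (1 + N%:Z) m (N ^ 2)%N%:Z *
    ((((h ^+ r) %% N%:Z)%Z ^+ N) %% (N ^ 2)%N%:Z)%Z) %% (N ^ 2)%N%:Z)%Z.

Definition fp_L (N : nat) (u : int) : int := ((u - 1) %/ N%:Z)%Z.

Definition fp_Dec (N alpha : nat) (c : int) : int :=
  ((fp_L N ((c ^+ (2 * alpha)%N) %% (N ^ 2)%N%:Z)%Z *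
    invmod (2 * alpha)%N%:Z N%:Z) %% N%:Z)%Z.

Definition DDLog (N : nat) (g : int) : int :=
  (((g %/ N%:Z)%Z * invmod (g %% N%:Z)%Z N%:Z) %% N%:Z)%Z.

Definition ct_div (N : nat) (c1 c0 : int) : int :=
  ((c1 * invmod c0 (N ^ 2)%N%:Z) %% (N ^ 2)%N%:Z)%Z.

(* Main.v *)
Require Import Defs.
From mathcomp Require Import all_boot all_order all_algebra zify ring.
From mathcomp Require Import cyclic.
Set Implicit Arguments. Unset Strict Implicit. Unset Printing Implicit Defensive.
Import Order.TTheory GRing.Theory Num.Theory.
Local Open Scope ring_scope.

(* In Z_(N^2) the element N squares to 0, so (1 + N)^k = 1 + k N and a FastPai
   ciphertext of m is (1 + m N) W with W^(2 alpha) = 1.  Since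
   (c* )^(2 alpha) = 1 + N, the shares satisfy (c* )^z1 = (c* )^z0 (1 + x y N), and
   DDLog turns this multiplicative relation into w1 = w0 + x y (mod N).  Hence
   Enc(w1) / Enc(w0) is a ciphertext of x y, which Dec recovers because raising
   to the power 2 alpha kills the mask W. *)

Lemma sqrn_gt1 (n : nat) : (1 < n)%N -> (1 < n ^ 2)%N.
Proof. by rewrite -(ltn_sqr 1). Qed.

Lemma half_ltn_even (m n : nat) : ~~ odd n -> (m < n)%N -> (m./2 < n./2)%N.
Proof. by move=> n_even; rewrite ltn_half_double even_halfK. Qed.

Lemma has_bits_ltn (a b x y : nat) : (a < b)%N -> has_bits a x -> has_bits b y -> (x < y)%N.
Proof.
move=> lt_ab /andP[_ x_lt] /andP[y_ge _].
by rewrite (leq_trans x_lt) // (leq_trans _ y_ge) // leq_exp2l //; lia.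
Qed.

Lemma odd_mod4_3 (m : nat) : (m %% 4 = 3)%N -> odd m.
Proof.
move=> m_mod4; have : (m %% 2 = 1)%N by lia.
by rewrite modn2; case: odd.
Qed.

Lemma dvdn_pred_ltn (d m : nat) : (1 < m)%N -> (d %| m.-1)%N -> (d < m)%N.
Proof. by move=> m_gt1 /dvdn_leq d_le; apply: leq_ltn_trans (d_le _) _; lia. Qed.

Lemma prime_coprime_ltn (p q : nat) : prime p -> prime q -> (q < p)%N -> coprime p q.
Proof. by move=> p_prime q_prime q_lt_p; rewrite prime_coprime // gtnNdvd ?prime_gt0. Qed.

Lemma fp_modulus_gt1 (P Q : nat) : prime P -> prime Q -> (1 < P * Q)%N.
Proof.
by move=> P_prime Q_prime; rewrite (leq_trans (prime_gt1 P_prime)) // leq_pmulr ?prime_gt0.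
Qed.

Section IntegersModM.

Variable M : nat.
Hypothesis M_gt1 : (1 < M)%N.

Lemma intr_Zp_eq0 (z : int) : ((z%:~R : 'Z_M) == 0) = (M%:Z %| z)%Z.
Proof.
have natr_Zp_eq0 (n : nat) : ((n%:R : 'Z_M) == 0) = (M %| n)%N.
  by rewrite -val_eqE /= val_Zp_nat.
case: z => n; first exact: natr_Zp_eq0.
by rewrite NegzE mulrNz oppr_eq0 dvdzE abszN natr_Zp_eq0.
Qed.

Lemma intr_Zp_eq (a b : int) : ((a%:~R : 'Z_M) == b%:~R) = (a == b %[mod M])%Z.
Proof. by rewrite -subr_eq0 -rmorphB intr_Zp_eq0 eqz_mod_dvd. Qed.

Lemma intr_Zp_mod (a : int) : ((a %% M)%Z%:~R : 'Z_M) = a%:~R.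
Proof. by apply/eqP; rewrite intr_Zp_eq modz_mod. Qed.

Lemma intr_Zp_unit (a : int) : ((a%:~R : 'Z_M) \is a GRing.unit) = coprimez a M.
Proof.
rewrite -intr_Zp_mod /coprimez -gcdz_modl.
have [k ->] : exists k : nat, (a %% M)%Z = k%:Z.
  by exists `|(a %% M)%Z|%N; rewrite gez0_abs ?modz_ge0 // eqz_nat -lt0n ltnW.
by rewrite -[(k%:Z)%:~R]/(k%:R) unitZpE // coprime_sym.
Qed.

Lemma invmod_Zp (a : int) : coprimez a M -> ((invmod a M)%:~R : 'Z_M) = (a%:~R)^-1.
Proof.
move=> /eqP coprime_a; rewrite /invmod intr_Zp_mod.
case: egcdzP => u v bezout _ /=; symmetry; apply: mulr1_eq.
have /eqP : (a * u)%:~R == 1 :> 'Z_M.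
  by rewrite -[1]/(1%:~R) intr_Zp_eq -coprime_a -bezout addrC modzMDl mulrC.
by rewrite -intrM.
Qed.

Lemma powmod_Zp (c z : int) : (c%:~R : 'Z_M) \is a GRing.unit ->
  ((powmod c z M)%:~R : 'Z_M) = (c%:~R) ^ z.
Proof.
rewrite intr_Zp_unit /powmod => coprime_c; case: z => k /=.
  by rewrite intr_Zp_mod rmorphXn.
by rewrite intr_Zp_mod rmorphXn /= invmod_Zp // exprVn.
Qed.

Lemma intr_Zp_char : ((M%:Z)%:~R : 'Z_M) = 0.
Proof. exact: pchar_Zp. Qed.

End IntegersModM.

Section SquareZero.

Variables (R : comUnitRingType) (nu : R).
Hypothesis nu_sqr : nu ^+ 2 = 0.

Lemma mul_1Dsqr0 (a b : R) : (1 + a * nu) * (1 + b * nu) = 1 + (a + b) * nu.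
Proof.
have -> : (1 + a * nu) * (1 + b * nu) = 1 + (a + b) * nu + a * b * nu ^+ 2 by ring.
by rewrite nu_sqr mulr0 addr0.
Qed.

Lemma exprn_1Dsqr0 (a : R) (k : nat) : (1 + a * nu) ^+ k = 1 + a *+ k * nu.
Proof.
elim: k => [|k IHk]; first by rewrite mulr0n mul0r addr0.
by rewrite exprS IHk mul_1Dsqr0 mulrS.
Qed.

Lemma invr_1Dsqr0 (a : R) : (1 + a * nu)^-1 = 1 - a * nu.
Proof. by apply: mulr1_eq; rewrite -mulNr mul_1Dsqr0 subrr mul0r addr0. Qed.

Lemma unit_1Dsqr0 (a : R) : 1 + a * nu \is a GRing.unit.
Proof. by apply/unitrPr; exists (1 - a * nu); rewrite -mulNr mul_1Dsqr0 subrr mul0r addr0. Qed.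

Lemma exprz_1Dsqr0 (a : R) (j : int) : (1 + a * nu) ^ j = 1 + a *~ j * nu.
Proof.
case: j => k; first exact: exprn_1Dsqr0.
change (((1 + a * nu) ^+ k.+1)^-1 = 1 + - (a *+ k.+1) * nu).
by rewrite exprn_1Dsqr0 invr_1Dsqr0 mulNr.
Qed.

End SquareZero.

Section ModulusSquare.

Variable N : nat.
Hypothesis N_gt1 : (1 < N)%N.

Let N2_gt1 : (1 < N ^ 2)%N := sqrn_gt1 N_gt1.

Lemma natr_Zp2_sqr : (N%:R : 'Z_(N ^ 2)) ^+ 2 = 0.
Proof. by rewrite -natrX pchar_Zp. Qed.

Lemma intr_Zp2_Zp (a b : int) :
  (a%:~R : 'Z_(N ^ 2)) = b%:~R -> (a%:~R : 'Z_N) = b%:~R.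
Proof.
move=> /eqP; rewrite intr_Zp_eq // eqz_mod_dvd => dvd_N2.
apply/eqP; rewrite intr_Zp_eq // eqz_mod_dvd; apply: dvdz_trans dvd_N2.
by rewrite -mulnn PoszM dvdz_mull.
Qed.

Lemma intr_mulN_Zp2_eq (a b : int) :
  ((a%:~R * N%:R : 'Z_(N ^ 2)) == b%:~R * N%:R) = ((a%:~R : 'Z_N) == b%:~R).
Proof.
rewrite -[N%:R]/((N%:Z)%:~R) -!intrM !intr_Zp_eq // !eqz_mod_dvd -mulrBl.
by rewrite -mulnn PoszM dvdz_mul2r // eqz_nat -lt0n ltnW.
Qed.

Lemma unit_Zp2_Zp (a : int) :
  (a%:~R : 'Z_(N ^ 2)) \is a GRing.unit -> (a%:~R : 'Z_N) \is a GRing.unit.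
Proof. by rewrite !intr_Zp_unit // -mulnn PoszM coprimezMr => /andP[]. Qed.

Lemma exprN_Zp2_eq1 (u : int) (e : nat) :
  (u%:~R : 'Z_N) ^+ e = 1 -> ((u ^+ N)%:~R : 'Z_(N ^ 2)) ^+ e = 1.
Proof.
move=> u_e; have : ((u ^+ e)%:~R : 'Z_N) == 1%:~R by rewrite rmorphXn u_e.
rewrite intr_Zp_eq // eqz_mod_dvd => /dvdzP [q u_e_1].
have -> : ((u ^+ N)%:~R : 'Z_(N ^ 2)) ^+ e = ((u ^+ e)%:~R) ^+ N.
  by rewrite !rmorphXn -!exprM mulnC.
rewrite (_ : u ^+ e = 1 + q * N%:Z); last by rewrite -u_e_1 addrC subrK.
rewrite rmorphD rmorphM /= (exprn_1Dsqr0 natr_Zp2_sqr) mulrnAl -mulrnAr -mulr_natr -expr2.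
by rewrite natr_Zp2_sqr mulr0 addr0.
Qed.

Lemma fp_L_Zp2 (D t : int) :
  (D%:~R : 'Z_(N ^ 2)) = 1 + t%:~R * N%:R -> ((fp_L N D)%:~R : 'Z_N) = t%:~R.
Proof.
move=> D_1DtN.
have /intr_Zp2_Zp : ((D - 1)%:~R : 'Z_(N ^ 2)) = (t * N%:Z)%:~R.
  by rewrite intrB D_1DtN intrM addrC addKr.
rewrite intrM intr_Zp_char // mulr0 => /eqP; rewrite intr_Zp_eq0 // => dvd_N.
apply/eqP; rewrite -intr_mulN_Zp2_eq -[N%:R]/((N%:Z)%:~R) -intrM divzK //.
by rewrite intrB D_1DtN addrC addKr.
Qed.

Lemma DDLog_mul_1DN (g0 g1 k : int) :
  (g0%:~R : 'Z_N) \is a GRing.unit ->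
  (g1%:~R : 'Z_(N ^ 2)) = g0%:~R * (1 + k%:~R * N%:R) ->
  ((DDLog N g1)%:~R : 'Z_N) = (DDLog N g0)%:~R + k%:~R.
Proof.
move=> g0_unit g1_def.
have g1_g0 : (g1%:~R : 'Z_(N ^ 2)) = (g0 + g0 * k * N%:Z)%:~R.
  by rewrite g1_def intrD !intrM mulrDr mulr1 mulrA.
have same_mod : (g1 %% N)%Z = (g0 %% N)%Z.
  apply/eqP; rewrite -intr_Zp_eq // (intr_Zp2_Zp g1_g0) intrD intrM intr_Zp_char //.
  by rewrite mulr0 addr0.
have divz_mulN (g : int) : (g %/ N)%Z * N = g - (g %% N)%Z.
  by rewrite {2}(divz_eq g N) addrK.
have quot : (((g1 %/ N)%Z)%:~R : 'Z_N) = ((g0 %/ N)%Z + g0 * k)%:~R.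
  apply/eqP; rewrite -intr_mulN_Zp2_eq -[N%:R]/((N%:Z)%:~R) -!intrM divz_mulN same_mod.
  rewrite (_ : (_ + _) * _ = g0 + g0 * k * N%:Z - (g0 %% N)%Z); last first.
    by rewrite mulrDl divz_mulN -mulrA addrAC.
  by rewrite !intrB g1_g0.
have coprime_g0 : coprimez (g0 %% N)%Z N by rewrite -intr_Zp_unit // intr_Zp_mod.
rewrite /DDLog !intr_Zp_mod // !intrM same_mod invmod_Zp // intr_Zp_mod //.
by rewrite quot intrD mulrDl intrM mulrAC mulrV // mul1r.
Qed.

Lemma DDLog_powmod_shift (c z0 z1 x : int) (e : nat) : (0 < e)%N ->
  (c%:~R : 'Z_(N ^ 2)) ^+ e = 1 + N%:R -> z1 = z0 + e%:Z * x ->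
  ((DDLog N (powmod c z1 (N ^ 2)%N%:Z))%:~R : 'Z_N) =
    (DDLog N (powmod c z0 (N ^ 2)%N%:Z))%:~R + x%:~R.
Proof.
move=> e_gt0 c_e z1_def.
have c_unit : (c%:~R : 'Z_(N ^ 2)) \is a GRing.unit.
  by rewrite -(unitrX_pos _ e_gt0) c_e -[N%:R]mul1r (unit_1Dsqr0 natr_Zp2_sqr).
apply: DDLog_mul_1DN; first by apply: unit_Zp2_Zp; rewrite powmod_Zp // unitrXz.
rewrite !powmod_Zp // z1_def exprzDr // -exprz_exp -exprnP c_e -[N%:R]mul1r.
by rewrite (exprz_1Dsqr0 natr_Zp2_sqr) mul1r.
Qed.

End ModulusSquare.

Section FastPaiCiphertexts.

Variables (N alpha : nat) (h : int).
Hypotheses (N_gt1 : (1 < N)%N) (coprime_N_2alpha : coprime N (2 * alpha)).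
Hypothesis h_order : (h%:~R : 'Z_N) ^+ (2 * alpha) = 1.

Let N2_gt1 : (1 < N ^ 2)%N := sqrn_gt1 N_gt1.

(* [(1 + N)^m = 1 + m N] in [Z_(N^2)], and [W] plays the role of the mask
   [(h^r mod N)^N]. *)
Definition fp_ciphertext (m c : int) : Prop :=
  exists2 W : 'Z_(N ^ 2), W ^+ (2 * alpha) = 1 &
    (c%:~R : 'Z_(N ^ 2)) = (1 + m%:~R * N%:R) * W.

Lemma fp_Enc_ciphertext (m : int) (r : nat) : 0 <= m -> fp_ciphertext m (fp_Enc N h m r).
Proof.
move=> m_ge0; exists (((h ^+ r %% N)%Z ^+ N)%:~R).
  apply: exprN_Zp2_eq1 => //.
  by rewrite intr_Zp_mod // rmorphXn -exprM mulnC exprM h_order expr1n.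
rewrite /fp_Enc intr_Zp_mod // intrM intr_Zp_mod //; congr (_ * _).
have [k ->] : exists k : nat, m = k%:Z by exists `|m|%N; rewrite gez0_abs.
rewrite /powmod /= intr_Zp_mod // rmorphXn /= intrD -[N%:~R]mul1r.
by rewrite (exprn_1Dsqr0 (natr_Zp2_sqr N_gt1)) mulr_natl.
Qed.

Let alpha2_gt0 : (0 < 2 * alpha)%N.
Proof.
by rewrite lt0n; apply: contraTneq coprime_N_2alpha => ->; rewrite /coprime gcdn0 gtn_eqF.
Qed.

Let coprimez_2alpha_N : coprimez (2 * alpha)%N N.
Proof. by rewrite coprimez_sym coprimezE. Qed.

Lemma fp_ciphertext_expr (m c : int) : fp_ciphertext m c ->
  (c%:~R : 'Z_(N ^ 2)) ^+ (2 * alpha) = 1 + m%:~R *+ (2 * alpha) * N%:R.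
Proof.
case=> W W_order ->.
by rewrite exprMn W_order mulr1 (exprn_1Dsqr0 (natr_Zp2_sqr N_gt1)).
Qed.

Lemma fp_ciphertext_unit (m c : int) :
  fp_ciphertext m c -> (c%:~R : 'Z_(N ^ 2)) \is a GRing.unit.
Proof.
move=> /fp_ciphertext_expr c_order.
by rewrite -(unitrX_pos _ alpha2_gt0) c_order (unit_1Dsqr0 (natr_Zp2_sqr N_gt1)).
Qed.

Lemma fp_Dec_ciphertext (m c : int) : fp_ciphertext m c -> (fp_Dec N alpha c = m %[mod N])%Z.
Proof.
move=> /fp_ciphertext_expr c_order; apply/eqP; rewrite -intr_Zp_eq // /fp_Dec.
rewrite intr_Zp_mod // intrM (@fp_L_Zp2 _ N_gt1 _ (m *+ (2 * alpha))); last first.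
  by rewrite intr_Zp_mod // rmorphXn /= c_order rmorphMn.
rewrite invmod_Zp // rmorphMn -mulr_natr -[(2 * alpha)%:R]/(((2 * alpha)%N%:Z)%:~R).
by rewrite mulrK // intr_Zp_unit.
Qed.

Lemma fp_ciphertext_div (m1 m0 c1 c0 : int) :
  fp_ciphertext m1 c1 -> fp_ciphertext m0 c0 -> fp_ciphertext (m1 - m0) (ct_div N c1 c0).
Proof.
move=> ct1 ct0; have c0_unit := fp_ciphertext_unit ct0.
case: ct1 => W1 W1_order c1_def; case: ct0 => W0 W0_order c0_def.
have W0_unit : W0 \is a GRing.unit.
  by rewrite -(unitrX_pos _ alpha2_gt0) W0_order unitr1.
exists (W1 / W0); first by rewrite exprMn exprVn W1_order W0_order invr1 mulr1.
have nu_sqr := natr_Zp2_sqr N_gt1.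
rewrite /ct_div intr_Zp_mod // intrM invmod_Zp -?intr_Zp_unit // c1_def c0_def.
rewrite invrM ?(unit_1Dsqr0 nu_sqr) // (invr_1Dsqr0 nu_sqr) intrB -mulNr.
by rewrite -(mul_1Dsqr0 nu_sqr); ring.
Qed.

Lemma fp_Enc_inv_expr (r : nat) :
  ((fp_Enc N h (invmod (2 * alpha)%N N) r)%:~R : 'Z_(N ^ 2)) ^+ (2 * alpha) = 1 + N%:R.
Proof.
rewrite (fp_ciphertext_expr (fp_Enc_ciphertext _ _)); last first.
  by rewrite modz_ge0 // eqz_nat -lt0n ltnW.
congr (1 + _).
rewrite -rmorphMn -[N%:R in RHS]mul1r -[1 in RHS]/(1%:~R); apply/eqP.
rewrite intr_mulN_Zp2_eq // rmorphMn /= invmod_Zp // -mulr_natr.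
by rewrite -[(2 * alpha)%:R]/(((2 * alpha)%N%:Z)%:~R) mulVr // intr_Zp_unit.
Qed.

Lemma S2C_correct (rstar r0 r1 : nat) (z0 z1 v : int) :
  z1 - z0 = (2 * alpha)%N%:Z * v ->
  let cstar := fp_Enc N h (invmod (2 * alpha)%N%:Z N%:Z) rstar in
  let w0 := DDLog N (powmod cstar z0 (N ^ 2)%N%:Z) in
  let w1 := DDLog N (powmod cstar z1 (N ^ 2)%N%:Z) in
  (fp_Dec N alpha (ct_div N (fp_Enc N h w1 r1) (fp_Enc N h w0 r0)) = v %[mod N])%Z.
Proof.
move=> z_diff cstar w0 w1.
have DDLog_ge0 (g : int) : 0 <= DDLog N g by rewrite modz_ge0 // eqz_nat -lt0n ltnW.
have w_diff : (w1%:~R : 'Z_N) = w0%:~R + v%:~R.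
  apply: (DDLog_powmod_shift N_gt1 alpha2_gt0 (fp_Enc_inv_expr rstar)).
  by rewrite -z_diff addrC subrK.
have C_ct : fp_ciphertext (w1 - w0) (ct_div N (fp_Enc N h w1 r1) (fp_Enc N h w0 r0)).
  by apply: fp_ciphertext_div; apply: fp_Enc_ciphertext; apply: DDLog_ge0.
rewrite (fp_Dec_ciphertext C_ct); apply/eqP.
by rewrite -intr_Zp_eq // intrB w_diff addrAC subrr add0r.
Qed.

End FastPaiCiphertexts.

Lemma fp_modulus_coprime_2alpha (P Q p q : nat) :
  prime P -> prime Q -> prime p -> prime q ->
  (P %% 4 = 3)%N -> (Q %% 4 = 3)%N ->
  (p < P)%N -> (p < Q)%N -> (q < P)%N -> (q < Q)%N ->
  coprime (P * Q) (2 * (p * q)).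
Proof.
move=> P_prime Q_prime p_prime q_prime P_mod4 Q_mod4 pP pQ qP qQ.
rewrite !coprimeMl !coprimeMr !coprimen2 !odd_mod4_3 //.
by rewrite !prime_coprime_ltn.
Qed.

Lemma fp_primes_neq (P Q p : nat) :
  prime p -> odd p -> (p %| P.-1)%N -> gcdn P.-1 Q.-1 = 2%N -> P != Q.
Proof.
move=> p_prime p_odd p_dvd gcd_2; apply/eqP => P_eq_Q.
move: gcd_2 p_dvd p_odd; rewrite P_eq_Q gcdnn => ->.
by rewrite dvdn_prime2 // => /eqP ->.
Qed.

Lemma fp_totient_modulus (P Q p q : nat) :
  prime P -> prime Q -> P != Q -> odd p -> odd q ->
  (p %| P.-1)%N -> (q %| Q.-1)%N -> (P %% 4 = 3)%N -> (Q %% 4 = 3)%N ->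
  totient (P * Q) = (4 * (p * q) * fp_beta P Q p q)%N.
Proof.
move=> P_prime Q_prime P_neq_Q p_odd q_odd p_dvd q_dvd P_mod4 Q_mod4.
have dvd_4alpha : (4 * (p * q) %| P.-1 * Q.-1)%N.
  rewrite (_ : 4 * (p * q) = (2 * p) * (2 * q))%N; last by rewrite mulnACA.
  by apply: dvdn_mul; rewrite Gauss_dvd ?coprime2n // ?p_dvd ?q_dvd andbT; lia.
rewrite totient_coprime ?prime_coprime ?dvdn_prime2 //.
by rewrite !totient_prime // /fp_beta [RHS]mulnC divnK.
Qed.

Lemma fp_h_order (P Q p q y0 : nat) : prime P -> prime Q ->
  totient (P * Q) = (4 * (p * q) * fp_beta P Q p q)%N -> coprime y0 (P * Q) ->
  ((fp_h (P * Q) y0 (fp_beta P Q p q))%:~R : 'Z_(P * Q)) ^+ (2 * (p * q)) = 1.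
Proof.
move=> P_prime Q_prime totient_PQ y0_coprime.
have N_gt1 := fp_modulus_gt1 P_prime Q_prime.
rewrite intr_Zp_mod // intrN exprM sqrrN -exprM rmorphXn /= -exprM.
rewrite (_ : (2 * _ * (2 * _))%N = totient (P * Q)); last by rewrite totient_PQ; ring.
by rewrite -natrX -Zp_nat_mod // (Euler_exp_totient y0_coprime) Zp_nat_mod.
Qed.

Theorem theorem3
  (kappa n : nat) (P Q p q : nat) (y0 rstar r0 r1 : nat) (x y z0 z1 : int) :
  (* FastPai key generation, l(kappa) = 4 kappa, n = n(kappa) > l(kappa) *)
  ~~ odd n -> (4 * kappa < n)%N ->
  prime P -> prime Q -> has_bits n./2 P -> has_bits n./2 Q ->
  prime p -> prime q -> odd p -> odd q ->
  has_bits (4 * kappa)./2 p -> has_bits (4 * kappa)./2 q ->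
  (p %| P.-1)%N -> (q %| Q.-1)%N ->
  (P %% 4 = 3)%N -> (Q %% 4 = 3)%N ->
  gcdn P.-1 Q.-1 = 2%N ->
  coprime (p * q) ((P.-1 * Q.-1) %/ (4 * (p * q))) ->
  (* y0 uniform in Z_N^* *)
  (y0 < P * Q)%N -> coprime y0 (P * Q) ->
  (* encryption randomness in {0,1}^l(kappa) *)
  (rstar < 2 ^ (4 * kappa))%N -> (r0 < 2 ^ (4 * kappa))%N -> (r1 < 2 ^ (4 * kappa))%N ->
  (* shares output by SMUL_HSS: z1 - z0 = 2 alpha x y (over the integers, see NOTES) *)
  z1 - z0 = (2 * (p * q))%N%:Z * x * y ->
  let N := (P * Q)%N in
  let alpha := (p * q)%N in
  let h := fp_h N y0 (fp_beta P Q p q) in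
  let cstar := fp_Enc N h (invmod (2 * alpha)%N%:Z N%:Z) rstar in
  let w0 := DDLog N (powmod cstar z0 (N ^ 2)%N%:Z) in
  let w1 := DDLog N (powmod cstar z1 (N ^ 2)%N%:Z) in
  let C := ct_div N (fp_Enc N h w1 r1) (fp_Enc N h w0 r0) in
  (fp_Dec N alpha C = x * y %[mod N%:Z])%Z.
Proof.
move=> n_even n_gt P_prime Q_prime P_bits Q_bits p_prime q_prime p_odd q_odd p_bits q_bits.
move=> p_dvd q_dvd P_mod4 Q_mod4 gcd_P1_Q1 _ _ y0_coprime _ _ _ z_diff.
have bits_ltn := has_bits_ltn (half_ltn_even n_even n_gt).
apply: S2C_correct.
- exact: fp_modulus_gt1.
- apply: fp_modulus_coprime_2alpha => //.
  + by apply: dvdn_pred_ltn; rewrite ?prime_gt1.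
  + exact: bits_ltn p_bits Q_bits.
  + exact: bits_ltn q_bits P_bits.
  + by apply: dvdn_pred_ltn; rewrite ?prime_gt1.
- apply: fp_h_order => //; apply: fp_totient_modulus => //.
  exact: fp_primes_neq p_prime p_odd p_dvd gcd_P1_Q1.
- by rewrite z_diff mulrA.
Qed.
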